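(* If $m\ge 3$ and $n\ge 2$ are integers, then $\mathrm{b}_1(P_m\mathbin{\square} P_n)=\mathrm{b}'_1(P_m\mathbin{\square} P_n)=2$.
   Context: $P_n$ denotes the path on $n$ vertices. The Cartesian product $G\mathbin{\square} F$ has vertex set $V(G)\times V(F)$, with $(x,y)$ and $(x',y')$ adjacent iff either $x=x'$ and $yy'\in E(F)$, or $y=y'$ and $xx'\in E(G)$. For positive integers $a,b$, the $(a,b)$-biased Maker-Breaker domination game on a graph $G$ is played by Dominator and Staller, who move alternately; on each move Dominator selects $a$ unplayed vertices and Staller selects $b$ unplayed vertices (if fewer unplayed vertices remain than the player's bias, the player selects all remaining ones). Dominator wins if the vertices he selected during the game form a dominating set of $G$; otherwise Staller wins, equivalently, Staller wins iff she claims all vertices of the closed neighborhood of some vertex. In the D-game Dominator moves first; in the S-game Staller moves first. For a positive integer $\ell$, $\mathrm{b}_\ell(G)$ (resp. $\mathrm{b}'_\ell(G)$) is the minimum positive integer $b$ such that Staller wins the $(\ell,b)$-biased D-game (resp. S-game) on $G$ under optimal play ($\infty$ if no such $b$ exists). *)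

(* Defs.v *)
From mathcomp Require Import all_boot.
From mathcomp Require Import boolp.

Set Implicit Arguments.
Unset Strict Implicit.
Unset Printing Implicit Defensive.

Record sgraph := SGraph {
  vertex :> finType;
  adj : rel vertex;
  adj_sym : symmetric adj;
  adj_irr : irreflexive adj }.

Definition path_adj (n : nat) : rel 'I_n :=
  fun i j => (i.+1 == j :> nat) || (j.+1 == i :> nat).

Lemma path_adj_sym n : symmetric (@path_adj n).
Proof. by move=> i j; rewrite /path_adj orbC. Qed.

Lemma path_adj_irr n : irreflexive (@path_adj n).
Proof. by move=> i; rewrite /path_adj orbb gtn_eqF. Qed.

Definition path_graph (n : nat) : sgraph :=
  SGraph (@path_adj_sym n) (@path_adj_irr n).

Definition cart_adj (G F : sgraph) : rel (G * F) :=
  fun u v => (u.1 == v.1) && adj u.2 v.2 || (u.2 == v.2) && adj u.1 v.1.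

Lemma cart_adj_sym G F : symmetric (@cart_adj G F).
Proof.
move=> u v; rewrite /cart_adj (eq_sym u.1) (eq_sym u.2).
by rewrite (adj_sym u.1) (adj_sym u.2).
Qed.

Lemma cart_adj_irr G F : irreflexive (@cart_adj G F).
Proof. by move=> u; rewrite /cart_adj !adj_irr !andbF. Qed.

Definition cart_prod (G F : sgraph) : sgraph :=
  SGraph (@cart_adj_sym G F) (@cart_adj_irr G F).

Definition dominating (G : sgraph) (D : {set G}) : Prop :=
  forall v : G, v \in D \/ exists2 u, u \in D & adj u v.

Variant player := Dominator | Staller.

Section Game.
Variables (G : sgraph) (a b : nat).
Implicit Types D S M : {set G}.

Definition unplayed D S : {set G} := ~: (D :|: S).

Definition legal_move (k : nat) D S M : Prop :=
  M \subset unplayed D S /\ #|M| = minn k #|unplayed D S|.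

(* [staller_wins p D S]: Staller has a winning strategy from the position where
   [D] and [S] are the vertices selected so far by Dominator and Staller, and
   [p] is to move.  For positive biases every play is finite, so this inductive
   predicate is the usual backward-induction value of the game. *)
Inductive staller_wins : player -> {set G} -> {set G} -> Prop :=
| SW_over p D S of unplayed D S = set0 & ~ dominating D :
    staller_wins p D S
| SW_Staller D S M of unplayed D S <> set0 & legal_move b D S M
    & staller_wins Dominator D (S :|: M) :
    staller_wins Staller D S
| SW_Dominator D S of unplayed D S <> set0
    & (forall M, legal_move a D S M -> staller_wins Staller (D :|: M) S) :
    staller_wins Dominator D S.

End Game.

Definition staller_wins_game (p : player) (G : sgraph) (a b : nat) : Prop :=
  staller_wins a b p (set0 : {set G}) set0.

(* Values in [option nat], with [None] standing for infinity. *)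
Definition min_positive (P : nat -> Prop) : option nat :=
  match pselect (exists b, (0 < b) && `[< P b >]) with
  | left exP => Some (ex_minn exP)
  | right _ => None
  end.

Definition bias (l : nat) (G : sgraph) : option nat :=
  min_positive (staller_wins_game Dominator G l).

Definition bias' (l : nat) (G : sgraph) : option nat :=
  min_positive (staller_wins_game Staller G l).

(* Main.v *)
(** With bias (1,1), Dominator wins by pairing: if every undominated vertex has
    in its closed neighborhood an unplayed pair, he answers in the pair that
    Staller enters.  If [m * n] is even, a domino tiling is such a pairing.  If
    [m] and [n] are odd, tile the complement of a corner 3 x 3 block; when Staller
    first enters the block, Dominator makes a reply after which the rest of the
    block admits a pairing depending on her move.
    With bias (1,2), opposite corners have disjoint closed neighborhoods, so
    Dominator's first vertex misses those of two corners on a common side; these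
    have three vertices each, and two moves of Staller make a double threat. *)

Require Import Defs.
From mathcomp Require Import all_boot.
From mathcomp Require Import boolp zify.

Set Implicit Arguments.
Unset Strict Implicit.
Unset Printing Implicit Defensive.

(** * Closed neighborhoods and finite sets *)

Definition closed_nbhd (G : sgraph) (v : G) : {set G} :=
  [set u | (u == v) || adj u v].

Lemma dominatingP (G : sgraph) (D : {set G}) :
  dominating D <-> forall v : G, exists2 u, u \in D & u \in closed_nbhd v.
Proof.
split=> H v.
  case: (H v) => [vD|[u uD uv]]; first by exists v; rewrite ?inE ?eqxx.
  by exists u; rewrite // inE uv orbT.
case: (H v) => u uD; rewrite inE => /orP[/eqP<-|uv]; first by left.
by right; exists u.
Qed.

(** Serves to pad a set of wanted vertices to the exact size that a move must have. *)
Lemma exists_between (T : finType) (A U : {set T}) (k : nat) :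
  A \subset U -> #|A| <= k -> k <= #|U| ->
  exists2 M : {set T}, A \subset M /\ M \subset U & #|M| = k.
Proof.
move=> AU; elim: k => [|k IH].
  by rewrite leqn0 => A0 _; exists A; [|apply/eqP].
rewrite leq_eqVlt => /orP[/eqP AK _|Ak kU]; first by exists A.
have [M [AM MU] Mk] := IH Ak (ltnW kU).
have /properP[_ [x xU xM]] : M \proper U by rewrite properEcard MU Mk.
exists (x |: M); last by rewrite cardsU1 xM Mk.
by rewrite subUset sub1set xU MU (subset_trans AM (subsetUr _ _)).
Qed.

Lemma disjointsU (T : finType) (A B C : {set T}) :
  [disjoint A :|: B & C] = [disjoint A & C] && [disjoint B & C].
Proof. by rewrite -!setI_eq0 setIUl setU_eq0. Qed.

(** * Staller's strategies: claimed neighborhoods, threats and double threats *)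

Section StallerStrategy.
Variable G : sgraph.
Implicit Types (D S M A B : {set G}) (v w : G).

Lemma unplayedUl D S M : unplayed (D :|: M) S = unplayed D S :\: M.
Proof. by apply/setP=> x; rewrite !inE; case: (x \in D); case: (x \in M); case: (x \in S). Qed.

Lemma unplayedUr D S M : unplayed D (S :|: M) = unplayed D S :\: M.
Proof. by apply/setP=> x; rewrite !inE; case: (x \in D); case: (x \in M); case: (x \in S). Qed.

Lemma unplayed_disjoint D S M : M \subset unplayed D S ->
  [disjoint M & D] /\ [disjoint M & S].
Proof.
move=> /subsetP MU; rewrite !disjoint_subset; split; apply/subsetP=> x /MU;
  by rewrite !inE negb_or => /andP[].
Qed.

Lemma not_dominating D v : [disjoint closed_nbhd v & D] -> ~ dominating D.
Proof.
move=> dis /dominatingP/(_ v)[u uD uv].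
by have := disjointFr dis uv; rewrite uD.
Qed.

Lemma legal_move_exists k D S A : A \subset unplayed D S -> #|A| <= k ->
  exists2 M : {set G}, A \subset M & legal_move k D S M.
Proof.
move=> AU Ak.
have [||M [AM MU] Mk] := @exists_between _ A _ (minn k #|unplayed D S|) AU.
- by rewrite leq_min Ak subset_leq_card.
- exact: geq_minr.
by exists M.
Qed.

Lemma legal_move_card k D S M : 0 < k -> unplayed D S <> set0 ->
  legal_move k D S M -> #|unplayed D S :\: M| < #|unplayed D S|.
Proof.
move=> k0 /eqP U0 [MU Mc]; rewrite cardsDS // Mc.
by move: U0; rewrite -card_gt0; lia.
Qed.

(** [staller_wins] is decided only on a full board, so the rest of the game is played out, by
    induction on the number of unplayed vertices. [D] stays disjoint from [S] and thus never meets
    the claimed neighborhood. *)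
Lemma staller_wins_claimed a b p D S v : 0 < a -> 0 < b ->
  closed_nbhd v \subset S -> [disjoint D & S] -> staller_wins a b p D S.
Proof.
move=> a0 b0; have [n] := ubnP #|unplayed D S|.
elim: n p D S => // n IH p D S leUn vS dDS.
have vD : [disjoint closed_nbhd v & D] by rewrite disjoint_sym (disjointWr vS).
have [U0|/eqP U0] := eqVneq (unplayed D S) set0.
  by apply: SW_over => //; exact: not_dominating vD.
case: p.
  apply: SW_Dominator => // M lM; have [MU _] := lM.
  have [_ MS] := unplayed_disjoint MU.
  apply: IH => //.
    by rewrite unplayedUl (leq_trans (legal_move_card _ _ lM)).
  by rewrite disjointsU dDS.
have [|M _ lM] := @legal_move_exists b D S set0 (sub0set _); first by rewrite cards0.
apply: (SW_Staller U0 lM); have [MU _] := lM.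
have [MD _] := unplayed_disjoint MU.
apply: IH.
- by rewrite unplayedUr (leq_trans (legal_move_card _ _ lM)).
- exact: subset_trans vS (subsetUl _ _).
- by rewrite disjoint_sym disjointsU disjoint_sym dDS.
Qed.

(** Staller takes all that is missing from the neighborhood in one move, padded to legal size. *)
Lemma staller_wins_threat a b D S v : 0 < a -> 0 < b ->
  [disjoint D & S] -> [disjoint closed_nbhd v & D] ->
  #|closed_nbhd v :\: S| <= b -> staller_wins a b Staller D S.
Proof.
move=> a0 b0 dDS vD vb.
have [U0|/eqP U0] := eqVneq (unplayed D S) set0.
  by apply: SW_over => //; exact: not_dominating vD.
have sub : closed_nbhd v :\: S \subset unplayed D S.
  apply/subsetP=> x; rewrite inE => /andP[xS xv].
  by rewrite !inE negb_or xS (disjointFr vD xv).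
have [M vM lM] := legal_move_exists sub vb.
have [MD _] := unplayed_disjoint (proj1 lM).
apply: (SW_Staller U0 lM); apply: (@staller_wins_claimed _ _ _ _ _ v) => //.
  by rewrite -subDset.
by rewrite disjoint_sym disjointsU disjoint_sym dDS.
Qed.

(** Dominator's single new vertex cannot lie in both neighborhoods, since their common part already
    belongs to Staller; the neighborhood it misses is then completed. *)
Lemma staller_wins_double_threat b D S v w : 0 < b ->
  [disjoint D & S] ->
  [disjoint closed_nbhd v & D] -> [disjoint closed_nbhd w & D] ->
  #|closed_nbhd v :\: S| <= b -> #|closed_nbhd w :\: S| <= b ->
  closed_nbhd v :&: closed_nbhd w \subset S ->
  staller_wins 1 b Dominator D S.
Proof.
move=> b0 dDS vD wD vb wb vwS.
have [U0|/eqP U0] := eqVneq (unplayed D S) set0.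
  by apply: SW_over => //; exact: not_dominating vD.
apply: SW_Dominator => // M [MU Mc].
have {Mc} /eqP/cards1P[y My] : #|M| = 1.
  by move/eqP: U0; rewrite -card_gt0; lia.
have [_ MS] := unplayed_disjoint MU.
have dDMS : [disjoint D :|: M & S] by rewrite disjointsU dDS.
have avoid u : y \notin closed_nbhd u -> [disjoint closed_nbhd u & D] ->
    [disjoint closed_nbhd u & D :|: M].
  by move=> yu uD; rewrite disjoint_sym My disjointsU disjoints1 disjoint_sym uD.
have [yv|yv] := boolP (y \in closed_nbhd v); last first.
  by apply: (@staller_wins_threat _ _ _ _ v) => //; exact: avoid.
apply: (@staller_wins_threat _ _ _ _ w) => //; apply: avoid => //.
apply/negP=> yw; move: MS; rewrite My disjoints1 => /negP; apply.
by apply: (subsetP vwS); rewrite inE yv.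
Qed.

(* Staller first takes the common part of the two neighborhoods, completed by
   private vertices so that both are reduced to at most two vertices. *)
Lemma staller_wins_two_small D v w :
  #|closed_nbhd v| <= 3 -> #|closed_nbhd w| <= 3 ->
  ~~ (closed_nbhd v \subset closed_nbhd w) ->
  ~~ (closed_nbhd w \subset closed_nbhd v) ->
  [disjoint closed_nbhd v & D] -> [disjoint closed_nbhd w & D] ->
  staller_wins 1 2 Staller D set0.
Proof.
move=> v3 w3 /subsetPn[p pv pw] /subsetPn[q qw qv] vD wD.
set A := closed_nbhd v in v3 pv qv vD *.
set B := closed_nbhd w in w3 pw qw wD *.
have pq : p != q by apply: contraNneq pw => ->.
have AB2 : #|A :&: B| <= 2.
  rewrite -ltnS (leq_trans _ v3) // proper_card // properE subsetIl.
  by apply/subsetPn; exists p; rewrite // inE pv.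
have sub2 (X Y : {set G}) z : z \in X -> z \in Y -> #|X| <= 3 -> #|X :\: Y| <= 2.
  move=> zX zY X3; rewrite -ltnS (leq_trans _ X3) // proper_card // properE subsetDl.
  by apply/subsetPn; exists z; rewrite // inE zY.
have [M [MAB ABM M2 [[x xA xM] [y yB yM]]]] : exists M : {set G},
    [/\ M \subset A :|: B, A :&: B \subset M, #|M| = 2 &
     (exists2 x, x \in A & x \in M) /\ (exists2 x, x \in B & x \in M)].
  (* Disjoint neighborhoods: one private vertex of each. Otherwise any 2-set between intersection
     and union works, as it contains a common vertex [c]. *)
  have [AB0|[c cAB]] := set_0Vmem (A :&: B).
    exists [set p; q]; rewrite AB0 sub0set cards2 pq; split=> //.
      by apply/subsetP=> z /set2P[]->; rewrite inE ?pv ?qw ?orbT.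
    by split; [exists p | exists q]; rewrite // !inE eqxx ?orbT.
  have := cAB; rewrite inE => /andP[cA cB].
  have sub : A :&: B \subset A :|: B.
    by apply: subset_trans (subsetIl _ _) (subsetUl _ _).
  have U2 : 2 <= #|A :|: B|.
    have <- : #|[set p; q]| = 2 by rewrite cards2 pq.
    apply: subset_leq_card; apply/subsetP=> z /set2P[]->; by rewrite inE ?pv ?qw ?orbT.
  have [M [ABM MAB] M2] := exists_between sub AB2 U2.
  exists M; split=> //; split; exists c => //; exact: (subsetP ABM).
have MD : [disjoint M & D] by rewrite (disjointWl MAB) // disjointsU vD.
have MU : M \subset unplayed D set0.
  by rewrite /unplayed setU0 -disjoints_subset.
have U0 : unplayed D set0 <> set0.
  move=> U0; move: MU; rewrite U0 subset0 => /eqP M0.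
  by move: M2; rewrite M0 cards0.
apply: (@SW_Staller _ _ _ D set0 M U0).
  by split; [exact: MU | apply/esym; rewrite M2; apply/minn_idPl; rewrite -M2 subset_leq_card].
rewrite set0U; apply: (@staller_wins_double_threat _ _ _ v w) => //.
- by rewrite disjoint_sym.
- exact: (sub2 _ _ x).
- exact: (sub2 _ _ y).
Qed.

End StallerStrategy.

(** * Dominator's strategies: a fixed pairing, and a pairing chosen when a block is entered *)

Section DominatorStrategy.
Variable G : sgraph.
Implicit Types (D S M T B : {set G}) (v x y s r : G) (mu : G -> G).

Lemma legal_move1 D S x : x \in unplayed D S -> legal_move 1 D S [set x].
Proof.
move=> xU; split; first by rewrite sub1set.
have : 0 < #|unplayed D S| by apply/card_gt0P; exists x.
by rewrite cards1; lia.
Qed.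

(** Invariant principle: [P] holds whenever Staller is to move, and Dominator can restore it after
    each of her moves. The first alternative covers a move of Staller that fills the board. *)
Lemma dominator_survives (P : {set G} -> {set G} -> Prop) :
  (forall D S, P D S -> unplayed D S = set0 -> dominating D) ->
  (forall D S s, P D S -> s \in unplayed D S ->
    unplayed D (S :|: [set s]) = set0 /\ dominating D \/
    exists2 y, y \in unplayed D (S :|: [set s]) &
               P (D :|: [set y]) (S :|: [set s])) ->
  forall D S, P D S -> ~ staller_wins 1 1 Staller D S.
Proof.
move=> Pend Pmove.
(* For the induction, the claim is extended to positions with Dominator to move: where Staller wins,
   he has neither already won nor a reply that leads into [P]. *)
suff H p D S : staller_wins 1 1 p D S -> match p with
      | Staller => ~ P D S
      | Dominator => ~ (unplayed D S = set0 /\ dominating D) /\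
          forall y, y \in unplayed D S -> ~ P (D :|: [set y]) S end.
  by move=> D S PDS /H.
elim=> {p D S} [p D S U0 nD|D S M U0 [MU M1] _ [IH1 IH2]|D S U0 sw IH].
- case: p; last by move=> /Pend/(_ U0).
  by split=> [[_]|y] //; rewrite U0 inE.
- have /eqP/cards1P[s sM] : #|M| = 1 by move/eqP: U0; rewrite -card_gt0; lia.
  move: MU IH1 IH2; rewrite sM sub1set => sU IH1 IH2 /Pmove/(_ sU)[//|[y yU]].
  exact: IH2.
- split=> [[]//|y yU]; exact: IH (legal_move1 yU).
Qed.

(** Fixed points of [mu] stand for unpaired vertices, hence the condition [mu x != x]. *)
Definition paired mu D S :=
  forall v, (exists2 u, u \in D & u \in closed_nbhd v) \/
  exists x, [/\ [&& x \in closed_nbhd v & mu x \in closed_nbhd v], mu x != x,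
                x \in unplayed D S & mu x \in unplayed D S].

(** Allows Dominator to imagine extra moves of Staller and withdraw them later. *)
Lemma paired_subr mu D S S' : S' \subset S -> paired mu D S -> paired mu D S'.
Proof.
move=> /subsetP sub Pm v; case: (Pm v) => [|[x [xv mx xU mxU]]]; first by left.
have U' y : y \in unplayed D S -> y \in unplayed D S'.
  by rewrite !inE !negb_or => /andP[-> yS]; apply: contra yS => /sub.
by right; exists x; split=> //; exact: U'.
Qed.

(** A pair that contains [y] now dominates its vertex; any other open pair is untouched by [T], by
    the hypothesis on [y]. With [T] empty this says that a free move of Dominator does no harm. *)
Lemma paired_reply mu D S T y : involutive mu -> paired mu D S ->
  (forall x, x \in T -> x \in unplayed D S -> mu x \in unplayed D S ->
     mu x != x -> y = mu x) ->
  paired mu (D :|: [set y]) (S :|: T).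
Proof.
move=> muK Pm yT v; case: (Pm v) => [[u uD uv]|[x [/andP[xv mxv] mx xU mxU]]].
  by left; exists u; rewrite // inE uD.
have yD' : y \in D :|: [set y] by rewrite !inE eqxx orbT.
have [yx|yx] := eqVneq y x; first by left; exists y => //; rewrite yx.
have [ymx|ymx] := eqVneq y (mu x); first by left; exists y => //; rewrite ymx.
right; exists x; split=> //; first by rewrite xv.
  rewrite unplayedUl unplayedUr !in_setD in_set1 xU eq_sym yx andbT /=.
  by apply/negP=> xT; move: ymx; rewrite (yT x) ?eqxx.
rewrite unplayedUl unplayedUr !in_setD in_set1 mxU eq_sym ymx andbT /=.
by apply/negP=> xT; move: yx; rewrite (yT (mu x)) ?muK ?eqxx // eq_sym.
Qed.

Lemma paired_dominating mu D S : paired mu D S -> unplayed D S = set0 -> dominating D.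
Proof.
move=> Pm U0; apply/dominatingP=> v; case: (Pm v) => // -[x [_ _]].
by rewrite U0 inE.
Qed.

Lemma paired_move mu D S s : involutive mu -> paired mu D S ->
  s \in unplayed D S ->
  unplayed D (S :|: [set s]) = set0 /\ dominating D \/
  exists2 y, y \in unplayed D (S :|: [set s]) &
             paired mu (D :|: [set y]) (S :|: [set s]).
Proof.
move=> muK Pm sU.
have [/andP[msU ms]|nms] := boolP ((mu s \in unplayed D S) && (mu s != s)).
  right; exists (mu s); first by rewrite unplayedUr in_setD1 ms.
  by apply: paired_reply => // x /set1P->.
have noreply y x : x \in [set s] -> x \in unplayed D S ->
    mu x \in unplayed D S -> mu x != x -> y = mu x.
  by move=> /set1P-> _ msU ms; move: nms; rewrite msU ms.
have [U0|[y yU]] := set_0Vmem (unplayed D (S :|: [set s])); last first.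
  by right; exists y => //; apply: paired_reply => //; exact: noreply.
(* The board is full after [s]. As [s] belonged to no open pair, an open pair for [v] would still be
   unplayed, so [v] is dominated. *)
left; split=> //; apply/dominatingP=> v.
case: (Pm v) => // -[x [_ mx xU mxU]].
have : x \in unplayed D (S :|: [set s]).
  rewrite unplayedUr in_setD1 xU andbT; apply: contraNneq nms => <-.
  by rewrite mx mxU.
by rewrite U0 inE.
Qed.

Lemma paired_safe mu D S : involutive mu -> paired mu D S ->
  ~ staller_wins 1 1 Staller D S.
Proof.
move=> muK; apply: (dominator_survives (P := paired mu)) => {}D {}S.
  exact: paired_dominating.
by move=> s; exact: paired_move.
Qed.

Lemma dominator_first_safe y :
  ~ staller_wins 1 1 Staller [set y] (set0 : {set G}) ->
  ~ staller_wins 1 1 Dominator (set0 : {set G}) set0.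
Proof.
have yU : y \in unplayed (set0 : {set G}) set0 by rewrite !inE.
move=> nsw sw; inversion sw as [p D S U0 _ e1 e2 e3| |D S _ sw' e1 e2].
  by move: yU; rewrite U0 inE.
by apply: nsw; have := sw' _ (legal_move1 yU); rewrite set0U.
Qed.

(* Holds until the first move in [B]: the matching [mu] of the complement of [B]
   is followed, and every matched pair is untouched or already settled. *)
Definition settled mu B D S :=
  B \subset unplayed D S /\
  forall v, v \notin B ->
    [&& v \in unplayed D S & mu v \in unplayed D S] \/
    [/\ v \notin unplayed D S, mu v \notin unplayed D S & (v \in D) || (mu v \in D)].

(** Here [s] is Staller's first move in [B], [r] the reply and [nu] the pairing used from then on.
    The pairs serving [B] lie inside [B], so play outside cannot have spoiled them. *)
Definition switches mu B s r nu :=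
  [/\ r \in B, r != s, involutive nu, {in ~: B, nu =1 mu} &
   forall v, v \in B -> r \in closed_nbhd v \/
     exists x, [/\ [&& x \in closed_nbhd v & nu x \in closed_nbhd v], nu x != x,
       x \in B :\: [set s; r] & nu x \in B :\: [set s; r]]].

Variables (mu : G -> G) (B : {set G}).
Hypothesis muK : involutive mu.
Hypothesis muB : forall v, v \notin B -> mu v \notin B.
Hypothesis mu_adj : forall v, v \notin B -> adj (mu v) v.

Lemma mu_nbhd v : v \notin B -> v \in closed_nbhd v /\ mu v \in closed_nbhd v.
Proof. by move=> vB; rewrite !inE eqxx mu_adj // orbT. Qed.

Lemma mu_neq v : v \notin B -> mu v != v.
Proof. by move=> /mu_adj; apply: contraTneq => ->; rewrite adj_irr. Qed.

Lemma settled_switch D S s r nu : s \in B -> settled mu B D S ->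
  switches mu B s r nu ->
  r \in unplayed D (S :|: [set s]) /\ paired nu (D :|: [set r]) (S :|: [set s]).
Proof.
move=> sB [BU out] [rB rs nuK nu_mu inB]; split.
  by rewrite unplayedUr in_setD1 rs (subsetP BU).
have U' x : x \in unplayed D S -> x != s -> x != r ->
    x \in unplayed (D :|: [set r]) (S :|: [set s]).
  by move=> xU xs xr; rewrite unplayedUl unplayedUr !in_setD1 xr xs.
move=> v; have [vB|vB] := boolP (v \in B).
  case: (inB v vB) => [rv|[x [xv nx]]].
    by left; exists r; rewrite // !inE eqxx orbT.
  rewrite !inE !negb_or => /andP[/andP[xs xr] xB] /andP[/andP[nxs nxr] nxB].
  by right; exists x; split=> //; apply: U' => //; exact: (subsetP BU).
have [vv mvv] := mu_nbhd vB.
have notB z x : z \notin B -> x \in B -> z != x by move=> zB xB; apply: contraNneq zB => ->.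
case: (out v vB) => [/andP[vU mvU]|[_ _ /orP[vD|vD]]]; last first.
- by left; exists (mu v); rewrite // inE vD.
- by left; exists v; rewrite // inE vD.
right; exists v.
have -> : nu v = mu v by apply: nu_mu; rewrite inE.
rewrite vv mvv mu_neq //.
by split=> //; apply: U' => //; apply: notB => //; exact: muB.
Qed.

Hypothesis sw : forall s, s \in B -> exists r nu, switches mu B s r nu.

Lemma settled_safe D S : settled mu B D S -> ~ staller_wins 1 1 Staller D S.
Proof.
(* The invariant has two phases: settled before Staller enters [B], paired by some [nu]
   afterwards. *)
move=> st; apply: (dominator_survives
  (P := fun D S => settled mu B D S \/
     exists2 nu, involutive nu & paired nu D S)); last by left.
  move=> {st}D {}S [[BU out] U0|[nu nuK Pn]]; last exact: paired_dominating Pn.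
  apply/dominatingP=> v.
  have [vv mvv] : v \in closed_nbhd v /\ mu v \in closed_nbhd v.
    by apply: mu_nbhd; apply/negP => /(subsetP BU); rewrite U0 inE.
  case: (out v); rewrite ?U0 ?inE //; last by case=> _ _ /orP[]; [exists v|exists (mu v)].
  by apply/negP => /(subsetP BU); rewrite U0 inE.
move=> {st}D {}S s [st|[nu nuK Pn]] sU; last first.
  by case: (paired_move nuK Pn sU) => [|[y yU Py]]; [left|right; exists y => //; right; exists nu].
right; have [sB|sB] := boolP (s \in B).
  have [r [nu swr]] := sw sB; have [rU Pr] := settled_switch sB st swr.
  by exists r => //; right; exists nu => //; case: swr.
have [BU out] := st.
case: (out s sB) => [/andP[_ msU]|[]]; last by rewrite sU.
(* A move outside [B] is answered by its partner, which settles that pair. *)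
exists (mu s); first by rewrite unplayedUr in_setD1 mu_neq.
left; split.
  rewrite unplayedUl unplayedUr !subsetD1 BU sB /= muB //.
move=> v vB; rewrite unplayedUl unplayedUr !in_setD1.
have [->|vs] := eqVneq v s.
  by right; rewrite !inE !eqxx !andbF !orbT.
have [->|vms] := eqVneq v (mu s).
  by right; rewrite muK !inE !eqxx !andbF !orbT.
have mvs : mu v != s by apply: contraNneq vms => <-; rewrite muK.
rewrite (inj_eq (inv_inj muK)) vs mvs /=.
by case: (out v vB) => [|[? ? /orP[] vD]]; [left|right; split; rewrite // !inE vD ?orbT..].
Qed.

End DominatorStrategy.

(** * Grids in natural-number coordinates, and Staller's win with bias 2 *)

Section Grid.
Variables m n : nat.
Notation grid := (cart_prod (path_graph m) (path_graph n)).
Implicit Types u v : grid.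

(** The closed-neighborhood relation of the grid, in a form open to [lia] and to computation. *)
Definition near (p q : nat * nat) : bool :=
  (p.1 == q.1) && [|| p.2 == q.2, p.2.+1 == q.2 | q.2.+1 == p.2] ||
  (p.2 == q.2) && ((p.1.+1 == q.1) || (q.1.+1 == p.1)).

Definition pos (v : grid) : nat * nat := (val v.1, val v.2).

Lemma pos_inj : injective pos.
Proof. by move=> [i j] [i' j'] [/val_inj/= -> /val_inj/= ->]. Qed.

Lemma mem_closed_nbhd u v : (u \in closed_nbhd v) = near (pos u) (pos v).
Proof.
case: u v => [i j] [i' j'].
have E k (x y : path_graph k) : (x == y) = (nat_of_ord x == nat_of_ord y) by [].
rewrite inE /near /= /cart_adj xpair_eqE /= !E /path_adj.
by case: (nat_of_ord i == i'); case: (nat_of_ord j == j'); rewrite ?orbF.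
Qed.

Lemma adj_near u v : adj u v = near (pos u) (pos v) && (pos u != pos v).
Proof.
rewrite (inj_eq pos_inj) -mem_closed_nbhd inE.
have [->|uv] := eqVneq u v; first by rewrite adj_irr andbF.
by rewrite andbT.
Qed.

Definition in_grid (p : nat * nat) := (p.1 < m) && (p.2 < n).

Lemma pos_in_grid v : in_grid (pos v).
Proof. by rewrite /in_grid /= !ltn_ord. Qed.

(** The defaults of [insubd] only make this total; [F] is meant to preserve the grid. *)
Definition lift (F : nat * nat -> nat * nat) (v : grid) : grid :=
  (insubd v.1 (F (pos v)).1, insubd v.2 (F (pos v)).2).

Lemma pos_lift F v : in_grid (F (pos v)) -> pos (lift F v) = F (pos v).
Proof.
by case/andP=> h1 h2; rewrite /pos /= !val_insubd h1 h2; case: (F _).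
Qed.

Lemma grid_of p : in_grid p -> exists v, pos v = p.
Proof. by case: p => i j /andP[hi hj]; exists (Ordinal hi, Ordinal hj). Qed.

Lemma lift_involutive F :
  (forall p, in_grid p -> in_grid (F p) /\ F (F p) = p) -> involutive (lift F).
Proof.
move=> H v; apply: pos_inj.
have [h1 h2] := H _ (pos_in_grid v); have [h3 _] := H _ h1.
by rewrite !pos_lift // pos_lift.
Qed.


Definition is_corner (p : nat * nat) :=
  ((p.1 == 0) || (p.1 == m.-1)) && ((p.2 == 0) || (p.2 == n.-1)).

Hypotheses (hm : 3 <= m) (hn : 2 <= n).

Lemma corner_card v : is_corner (pos v) -> #|closed_nbhd v| <= 3.
Proof.
case pv: (pos v) => [i j]; rewrite /is_corner /= => cv.
have [u1 pu1] : exists u1 : grid, pos u1 = (if i == 0 then 1 else m.-2, j).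
  by apply: grid_of; have := pos_in_grid v; rewrite pv /in_grid /=; case: ifP; lia.
have [u2 pu2] : exists u2 : grid, pos u2 = (i, if j == 0 then 1 else n.-2).
  by apply: grid_of; have := pos_in_grid v; rewrite pv /in_grid /=; case: ifP; lia.
have sub : closed_nbhd v \subset [set v; u1] :|: [set u2].
  apply/subsetP=> u; rewrite mem_closed_nbhd !in_setU !in_set1.
  rewrite -!(inj_eq pos_inj) pu1 pu2 pv.
  have := pos_in_grid u; case: (pos u) => a b; rewrite /in_grid /near /= !xpair_eqE.
  by case: ifP; case: ifP; lia.
apply: leq_trans (subset_leq_card sub) _.
apply: leq_trans (leq_card_setU _ _) _.
by rewrite cards2 cards1; case: eqP.
Qed.

Lemma corner_nsubset u v : is_corner (pos u) -> is_corner (pos v) ->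
  ((pos u).1 == (pos v).1) != ((pos u).2 == (pos v).2) ->
  ~~ (closed_nbhd u \subset closed_nbhd v).
Proof.
move=> cu cv; case pu: (pos u) cu => [i j]; case pv: (pos v) cv => [i' j'].
rewrite /is_corner /= => cv cu hne.
(* The neighbor of [u] perpendicular to the side shared with [v]: it differs from [v] in both
   coordinates. *)
have [w pw] : exists w : grid,
    pos w = if i == i' then (if i == 0 then 1 else m.-2, j)
            else (i, if j == 0 then 1 else n.-2).
  apply: grid_of; have := pos_in_grid u; rewrite pu /in_grid /=.
  by case: ifP => ?; case: ifP => ? /=; lia.
apply/subsetPn; exists w; rewrite mem_closed_nbhd pw ?pu ?pv /near.
  by case: ifP => ?; case: ifP => ? /=; lia.
by case: ifP hne => ?; case: ifP => ? /=; lia.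
Qed.

(** Opposite corners are at distance at least 2 + 1 = 3, so [x] is in at most one of the two closed
    neighborhoods. *)
Lemma opposite_corner i j x : is_corner (i, j) ->
  exists2 u : grid, is_corner (pos u) /\
    (pos u = (i, j) \/ pos u = (m.-1 - i, n.-1 - j)) & x \notin closed_nbhd u.
Proof.
move=> cij; have := cij; rewrite {1}/is_corner /= => ij.
have [u pu] : exists u : grid, pos u = (i, j).
  by apply: grid_of; rewrite /in_grid /=; lia.
have [v pv] : exists v : grid, pos v = (m.-1 - i, n.-1 - j).
  by apply: grid_of; rewrite /in_grid /=; lia.
have [xu|xu] := boolP (x \in closed_nbhd u); last first.
  by exists u; rewrite ?pu; first by split; [exact: cij|left].
exists v; first by rewrite pv; split; [rewrite /is_corner /=; lia|right].
move: xu; rewrite !mem_closed_nbhd pu pv /near /=; lia.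
Qed.

(** One corner avoiding [x] is taken from each diagonal; two such corners share a side. The
    inclusion covers both games: [D] is empty or Dominator's first vertex. *)
Lemma staller_wins_after x (D : {set grid}) : D \subset [set x] ->
  staller_wins 1 2 Staller D set0.
Proof.
move=> Dx.
have [u [cu pu] xu] := @opposite_corner 0 0 x ltac:(by rewrite /is_corner /=; lia).
have [v [cv pv] xv] := @opposite_corner 0 n.-1 x ltac:(by rewrite /is_corner /=; lia).
have avoid w : x \notin closed_nbhd w -> [disjoint closed_nbhd w & D].
  by move=> xw; rewrite disjoint_sym (disjointWl Dx) // disjoints1.
apply: (@staller_wins_two_small _ _ u v); rewrite ?corner_card ?avoid //.
  by apply: corner_nsubset => //; case: pu pv => -> [] -> /=; lia.
by apply: corner_nsubset => //; case: pu pv => -> [] -> /=; lia.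
Qed.

Lemma staller_wins_bias2 p : staller_wins 1 2 p (set0 : {set grid}) set0.
Proof.
have [o _] : exists o : grid, pos o = (0, 0).
  by apply: grid_of; rewrite /in_grid /=; lia.
have oU : o \in unplayed (set0 : {set grid}) set0 by rewrite !inE.
case: p; last by apply: (@staller_wins_after o); rewrite sub0set.
apply: SW_Dominator => [U0|M [MU M1]]; first by rewrite U0 inE in oU.
have /eqP/cards1P[x ->] : #|M| = 1.
  have : 0 < #|unplayed (set0 : {set grid}) set0| by apply/card_gt0P; exists o.
  by lia.
by rewrite set0U; apply: (@staller_wins_after x).
Qed.

Lemma lift_adj F v : in_grid (F (pos v)) -> near (F (pos v)) (pos v) ->
  F (pos v) != pos v -> adj (lift F v) v.
Proof. by move=> Fg Fn Fv; rewrite adj_near pos_lift // Fn. Qed.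

Lemma dominoes_safe F :
  (forall p, in_grid p -> [/\ in_grid (F p), F (F p) = p, near (F p) p & F p != p]) ->
  forall p, ~ staller_wins 1 1 p (set0 : {set grid}) set0.
Proof.
move=> FP.
have muK : involutive (lift F) by apply: lift_involutive => p /FP[].
have muP : paired (lift F) set0 set0.
  move=> v; right; exists v; have [Fg _ Fn Fv] := FP _ (pos_in_grid v).
  split; rewrite ?inE // ?eqxx ?lift_adj ?orbT //.
  by rewrite -(inj_eq pos_inj) pos_lift.
have [o _] : exists o : grid, pos o = (0, 0).
  by apply: grid_of; rewrite /in_grid /=; lia.
case; last exact: paired_safe muP.
(* In the D-game an arbitrary first vertex keeps the pairing. *)
apply: (@dominator_first_safe _ o); apply: (paired_safe muK).
rewrite -[[set o]]set0U -[X in paired _ _ X]setU0.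
by apply: paired_reply => // x; rewrite inE.
Qed.

End Grid.
Arguments pos_inj {m n}.

(** * Domino tilings of a line, and grids with an even side *)

Definition even_partner k := if odd k then k.-1 else k.+1.
(** Pairs 3 with 4, 5 with 6, and so on; the indices 0, 1, 2 are left to the block. *)
Definition odd_partner k := if odd k then k.+1 else k.-1.

Lemma even_partnerP n k : ~~ odd n -> k < n ->
  [/\ even_partner k < n, even_partner (even_partner k) = k &
      ((even_partner k).+1 == k) || (k.+1 == even_partner k)].
Proof.
rewrite /even_partner => en kn; case: ifP => ok; last by rewrite /= ok /=; split; lia.
by rewrite ifF; [split; lia | lia].
Qed.

Lemma odd_partnerP n k : odd n -> 3 <= k -> k < n ->
  [/\ 3 <= odd_partner k < n, odd_partner (odd_partner k) = k &
      ((odd_partner k).+1 == k) || (k.+1 == odd_partner k)].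
Proof.
rewrite /odd_partner => on k3 kn; case: ifP => ok.
  by rewrite /= ok /=; split; lia.
by rewrite ifT; [split; lia | lia].
Qed.

Lemma even_grid_safe m n p : 3 <= m -> 2 <= n -> ~~ (odd m && odd n) ->
  ~ staller_wins 1 1 p (set0 : {set cart_prod (path_graph m) (path_graph n)}) set0.
Proof.
move=> hm hn; have [om /= on|em _] := boolP (odd m).
  apply: (@dominoes_safe m n hm hn (fun p => (p.1, even_partner p.2))).
  move=> [i j]; rewrite /in_grid /near /= => /andP[im jn].
  have [g -> a] := even_partnerP on jn.
  by split; rewrite ?xpair_eqE //; lia.
apply: (@dominoes_safe m n hm hn (fun p => (even_partner p.1, p.2))).
move=> [i j]; rewrite /in_grid /near /= => /andP[im jn].
have [g -> a] := even_partnerP em im.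
by split; rewrite ?xpair_eqE //; lia.
Qed.

(** * The 3 x 3 block and its table of replies *)

Definition block := [seq (i, j) | i <- iota 0 3, j <- iota 0 3].
Definition in_block (p : nat * nat) := (p.1 < 3) && (p.2 < 3).
Definition encode (p : nat * nat) := 3 * p.1 + p.2.
Definition decode (c : nat) := (c %/ 3, c %% 3).

(* Cell [(i, j)] of the block is numbered [3 * i + j].  The entry at [s] gives
   Dominator's reply to [s] and the pairing used from then on, as the list of
   the partners of 0, ..., 8; unpaired cells are their own partners. *)
Definition block_table : seq (nat * seq nat) :=
  [:: (1, [:: 0; 1; 5; 6; 4; 2; 3; 8; 7]);
      (3, [:: 4; 1; 5; 3; 0; 2; 6; 8; 7]);
      (1, [:: 3; 1; 2; 0; 4; 8; 7; 6; 5]);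
      (1, [:: 4; 1; 2; 3; 0; 8; 7; 6; 5]);
      (1, [:: 0; 1; 5; 6; 4; 2; 3; 8; 7]);
      (1, [:: 0; 1; 4; 6; 2; 5; 3; 8; 7]);
      (7, [:: 3; 2; 1; 0; 4; 8; 6; 7; 5]);
      (3, [:: 0; 2; 1; 3; 6; 8; 4; 7; 5]);
      (7, [:: 1; 0; 5; 6; 4; 2; 3; 7; 8])].

Definition block_entry (s : nat * nat) := nth (0, [::]) block_table (encode s).
Definition block_reply s := decode (block_entry s).1.
Definition block_partner s p := decode (nth 0 (block_entry s).2 (encode p)).

Lemma mem_block p : in_block p -> p \in block.
Proof. by case: p => [[|[|[|i]]] [|[|[|j]]]]. Qed.

Lemma block_reply_correct s : in_block s ->
  in_block (block_reply s) /\ block_reply s != s.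
Proof.
have /allP tab : all (fun s => in_block (block_reply s) && (block_reply s != s)) block.
  by vm_compute.
by move=> /mem_block/tab/andP.
Qed.

Lemma block_partnerK s p : in_block s -> in_block p ->
  in_block (block_partner s p) /\ block_partner s (block_partner s p) = p.
Proof.
have /allP tab : all (fun s => all (fun p => in_block (block_partner s p) &&
    (block_partner s (block_partner s p) == p)) block) block by vm_compute.
by move=> /mem_block/tab/allP{}tab /mem_block/tab/andP[? /eqP].
Qed.

(** Checked by computation, within the block and so independently of [m] and [n]. Pairs need not be
    dominoes: the diagonal cells 0 and 4 serve both 1 and 3. *)
Lemma block_dominated s p : in_block s -> in_block p ->
  near (block_reply s) p \/
  exists x, let y := block_partner s x in
    [/\ near x p && near y p, y != x, in_block x && in_block y &
        (x != s) && (x != block_reply s) && ((y != s) && (y != block_reply s))].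
Proof.
have /allP tab : all (fun s => all (fun p => near (block_reply s) p ||
    has (fun x => let y := block_partner s x in
      [&& near x p && near y p, y != x, in_block x && in_block y &
       (x != s) && (x != block_reply s) && ((y != s) && (y != block_reply s))])
      block) block) block by vm_compute.
move=> /mem_block/tab/allP{}tab /mem_block/tab/orP[|/hasP[x _ /and4P[]]]; first by left.
by right; exists x.
Qed.

(** Outside the block the value does not depend on [s]: first coordinates from 3 on are paired, and
    the remaining strip is paired along the second coordinate. *)
Definition block_tiling s (p : nat * nat) :=
  if in_block p then block_partner s p
  else if 3 <= p.1 then (odd_partner p.1, p.2) else (p.1, odd_partner p.2).

(** * Grids with both sides odd *)

Section OddGrid.
Variables m n : nat.
Hypotheses (hm : 3 <= m) (hn : 3 <= n) (om : odd m) (on : odd n).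
Notation grid := (cart_prod (path_graph m) (path_graph n)).

Lemma block_in_grid p : in_block p -> in_grid m n p.
Proof. by rewrite /in_block /in_grid; lia. Qed.

Lemma block_tilingK s : in_block s -> involutive (lift (block_tiling s) : grid -> grid).
Proof.
move=> sB; apply: lift_involutive => p pg; rewrite {3}/block_tiling.
have [pB|pB] := boolP (in_block p).
  have [qB qK] := block_partnerK sB pB.
  by rewrite /block_tiling pB qB qK; split=> //; exact: block_in_grid.
case: p pg pB => i j; rewrite /in_grid /in_block /= => pg pB.
case/andP: pg => im jn; rewrite /block_tiling /in_block /= (negbTE pB).
have [i3|i3] := leqP 3 i => /=.
  have [/andP[g3 gm] -> _] := odd_partnerP om i3 im.
  by rewrite gm jn g3 ltnNge g3.
have j3 : 3 <= j by lia.
have [/andP[g3 gn] -> _] := odd_partnerP on j3 jn.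
have -> : (odd_partner j < 3) = false by lia.
have -> : (2 < i) = false by lia.
by rewrite im gn andbF.
Qed.

Lemma block_tiling_out s p : in_grid m n p -> ~~ in_block p ->
  let q := block_tiling s p in
  [/\ in_grid m n q, ~~ in_block q, near q p & q != p].
Proof.
case: p => i j pg pB; rewrite /block_tiling (negbTE pB).
case/andP: pg pB => im jn; rewrite /in_grid /in_block /near /= in im jn * => pB.
case: ifP => i3; first by have [? _ ?] := odd_partnerP om i3 im; split;
  rewrite ?xpair_eqE /=; lia.
have j3 : 3 <= j by lia.
by have [? _ ?] := odd_partnerP on j3 jn; split; rewrite ?xpair_eqE /=; lia.
Qed.

Definition corner_block : {set grid} := [set v | in_block (pos v)].

(** The index [(0, 0)] is an arbitrary choice, as all the tilings agree outside the block. *)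
Lemma corner_block_switches (s : grid) : s \in corner_block ->
  exists r, switches (lift (block_tiling (0, 0))) corner_block s r
                     (lift (block_tiling (pos s))).
Proof.
rewrite inE => sB; have [rB rs] := block_reply_correct sB.
have [r pr] := grid_of (block_in_grid rB); exists r; split.
- by rewrite inE pr.
- by apply: contraNneq rs => e; rewrite -pr e.
- exact: block_tilingK.
- move=> v; rewrite !inE => vB; apply: pos_inj.
  have [g1 _ _ _] := block_tiling_out (0, 0) (pos_in_grid v) vB.
  have [g2 _ _ _] := block_tiling_out (pos s) (pos_in_grid v) vB.
  by rewrite !pos_lift //; rewrite /block_tiling (negbTE vB).
move=> v; rewrite inE => vB.
case: (block_dominated sB vB) => [rv|[q]].
  by left; rewrite mem_closed_nbhd pr.
set q' := block_partner _ _ => -[nq qq' /andP[qB q'B] qsr].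
have [x px] := grid_of (block_in_grid qB).
have tx : block_tiling (pos s) (pos x) = q' by rewrite /block_tiling px qB.
have px' : pos (lift (block_tiling (pos s)) x) = q'.
  by rewrite pos_lift tx // block_in_grid.
right; exists x; rewrite !mem_closed_nbhd !in_setD !in_set2 -!(inj_eq pos_inj).
by rewrite !inE px' px pr !negb_or qB q'B !andbT; case/andP: qsr => -> ->.
Qed.

Lemma odd_grid_safe p : ~ staller_wins 1 1 p (set0 : {set grid}) set0.
Proof.
set mu : grid -> grid := lift (block_tiling (0, 0)).
have muK : involutive mu by exact: block_tilingK.
have out v : v \notin corner_block ->
    [/\ pos (mu v) = block_tiling (0, 0) (pos v), mu v \notin corner_block &
        adj (mu v) v].
  rewrite !inE => vB; have [g b nr ne] := block_tiling_out (0, 0) (pos_in_grid v) vB.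
  by rewrite lift_adj // pos_lift.
have st : settled mu corner_block set0 set0.
  split; first by apply/subsetP=> v; rewrite !inE.
  by move=> v _; left; rewrite !inE.
have muB v : v \notin corner_block -> mu v \notin corner_block by move=> /out[].
have mu_adj v : v \notin corner_block -> adj (mu v) v by move=> /out[].
case: p; last first.
  apply: (settled_safe muK muB mu_adj _ st) => s /corner_block_switches[r sw].
  by exists r, (lift (block_tiling (pos s))).
(* In the D-game Dominator imagines that Staller has opened at [o], plays the reply [r], and then
   withdraws [o]. *)
have [o po] : exists o : grid, pos o = (0, 0).
  by apply: grid_of; rewrite /in_grid /=; lia.
have oB : o \in corner_block by rewrite inE po.
have [r sw] := corner_block_switches oB.
have [_ Pr] := settled_switch muB mu_adj oB st sw.
apply: (@dominator_first_safe _ r).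
have [_ _ nuK _ _] := sw; apply: (paired_safe nuK).
rewrite -[[set r]]set0U; apply: paired_subr Pr; exact: subsetUl.
Qed.

End OddGrid.

(** * The threshold bias *)

Lemma min_positive_2 (P : nat -> Prop) : ~ P 1 -> P 2 -> min_positive P = Some 2.
Proof.
move=> P1 P2; rewrite /min_positive; case: pselect => [exP|[]]; last first.
  by exists 2; apply/asboolP.
case: ex_minnP => k /andP[k0 /asboolP Pk] /(_ 2).
rewrite (asboolT P2) => /(_ isT) k2; congr Some.
by case: k k0 Pk k2 => [|[|[|k]]].
Qed.

Theorem proposition15 (m n : nat) (hm : 3 <= m) (hn : 2 <= n) :
  bias 1 (cart_prod (path_graph m) (path_graph n)) = Some 2 /\
  bias' 1 (cart_prod (path_graph m) (path_graph n)) = Some 2.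
Proof.
have safe p : ~ staller_wins_game p (cart_prod (path_graph m) (path_graph n)) 1 1.
  have [/andP[om on]|e] := boolP (odd m && odd n); last exact: even_grid_safe.
  (* An odd [n] with [2 <= n] is at least 3, so the block fits. *)
  by apply: odd_grid_safe => //; lia.
by split; apply: min_positive_2 => //; exact: staller_wins_bias2.
Qed.
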